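(* Let $\nu\ge 1$ be an integer and let $\widetilde{L}_\nu(t)=\left.\left(\frac{d}{du}\right)^{\nu}(u^2-1)^{\nu}\right|_{u=2t-1}$, a polynomial in $t$ of degree $\nu$. Among all $(2\nu)$-indistinguishable finite bias distributions, there is a unique one with the minimal number of possible output values, namely the distribution $\mathcal{P}_{2\nu}$ whose possible outputs are the zeroes $p$ of $\widetilde{L}_\nu$, each output $p$ being taken with probability $\frac{C}{(p(1-p))^{3/2}\,\widetilde{L}_\nu{}'(p)^2}$, where $C>0$ is the normalizing constant making the probabilities sum to $1$. This distribution has exactly $\nu$ possible outputs.
   Context: A finite bias distribution is a probability distribution $\mathcal{P}$ supported on a finite subset of the open interval $(0,1)$ that is symmetric: for every $a$, $\mathcal{P}$ outputs $a$ and $1-a$ with the same probability. $E_p$ denotes expectation over $p$ drawn from $\mathcal{P}$. For $0<p<1$ put $\sigma(p)=\sqrt{(1-p)/p}$, and for integers $\ell\ge 1$, $0\le x\le\ell$ put $f_{\ell,x}(p)=p^x(1-p)^{\ell-x}\bigl(x\sigma(p)-(\ell-x)\sigma(1-p)\bigr)$ and $R_{\ell,x}=\max\{0,E_p[f_{\ell,x}(p)]\}$. For a positive integer $c$, $\mathcal{P}$ is called $c$-indistinguishable if $\sum_{x=1}^{\ell-1}\binom{\ell}{x}R_{\ell,x}=0$ for all $2\le\ell\le c$. ''Number of possible outputs'' means the size of the support of the distribution. *)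

(* Defs.v *)
From HB Require Import structures.
From mathcomp Require Import all_boot all_order all_algebra.
From mathcomp Require Import reals.
Set Implicit Arguments. Unset Strict Implicit. Unset Printing Implicit Defensive.
Import Order.TTheory GRing.Theory Num.Theory.
Local Open Scope ring_scope.

Section Defs.
Variable R : realType.

(* A finite bias distribution is given by its probability mass function
   P : R -> R together with a duplicate-free list s enumerating exactly its
   support (the points of positive probability). *)
Definition is_fbd (P : R -> R) (s : seq R) : Prop :=
  [/\ uniq s /\ (forall x, (x \in s) = (0 < P x)),
      forall x, 0 <= P x,
      \sum_(x <- s) P x = 1,
      {in s, forall x, 0 < x < 1} &
      forall a, P (1 - a) = P a].

Definition Ex (P : R -> R) (s : seq R) (g : R -> R) : R :=
  \sum_(x <- s) P x * g x.

Definition sigma (p : R) : R := Num.sqrt ((1 - p) / p).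

Definition fbias (l x : nat) (p : R) : R :=
  p ^+ x * (1 - p) ^+ (l - x) *
  (x%:R * sigma p - (l - x)%:R * sigma (1 - p)).

Definition Rlx (P : R -> R) (s : seq R) (l x : nat) : R :=
  Num.max 0 (Ex P s (fbias l x)).

Definition indistinguishable (c : nat) (P : R -> R) (s : seq R) : Prop :=
  forall l : nat, (2 <= l <= c)%N ->
    \sum_(1 <= x < l) 'C(l, x)%:R * Rlx P s l x = 0.

Definition Ltilde (nu : nat) : {poly R} :=
  (derivn nu (('X ^+ 2 - 1) ^+ nu)) \Po (2%:P * 'X - 1).

Definition Pnu (nu : nat) (C : R) (p : R) : R :=
  if root (Ltilde nu) p then
    C / (Num.sqrt (p * (1 - p)) ^+ 3 * ((Ltilde nu)^`()).[p] ^+ 2)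
  else 0.

End Defs.

(* Main.v *)
(** Put [v p = P p * sqrt (p (1 - p))].  Then [Ex P s (fbias l x)] is the
    [v]-sum of the derivative of [p^x (1-p)^(l-x)], and by the symmetry of [P]
    indistinguishability forces these sums to vanish, not merely to be
    nonpositive.  So [P] is [2 nu]-indistinguishable iff [v] annihilates [h']
    for every [h] of degree at most [2 nu] with [h 0 = h 1 = 0], i.e. iff [v] is
    proportional to a quadrature rule on [[0, 1]] exact up to degree
    [2 nu - 1].  With [nu] nodes the only such rule is the Gauss-Legendre one:
    [L := Ltilde nu] has [nu] roots in [(0, 1)] by Rolle, is orthogonal to
    lower degrees by integration by parts, and the interpolatory weights at its
    roots are exact.  Taking [h = X (1 - X) (L / (X - x)) (L / (X - y))] for two
    roots [x <> y] shows that [v x * x (1 - x) L'(x)^2] does not depend on the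
    root [x]; this yields both the formula for the weights and their
    positivity.  Finally, if [s] has at most [nu] points and [M] vanishes on
    [s], exactness for [M * (L / (X - x))] gives [M x = 0], so every root of
    [L] lies in [s]. *)
Require Import Defs.
From HB Require Import structures.
From mathcomp Require Import all_boot all_order all_algebra.
From mathcomp Require Import polyorder polyrcf cauchyreals.
From mathcomp Require Import boolp reals.
From mathcomp Require Import ring zify.
Set Implicit Arguments.
Unset Strict Implicit.
Import Order.TTheory GRing.Theory Num.Theory.
Local Open Scope ring_scope.

(** * Algebraic integration of polynomials over [[0, 1]] *)

Section Primitive.
Variable R : realFieldType.
Implicit Types p q : {poly R}.

Definition poly_prim p : {poly R} :=
  \poly_(i < (size p).+1) (p`_i.-1 / i%:R).

(* At [i = 0] the right-hand side is [p`_0 / 0 = 0]. *)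
Lemma coef_poly_prim p i : (poly_prim p)`_i = p`_i.-1 / i%:R.
Proof.
rewrite coef_poly; case: ltnP => // le_pi.
by rewrite nth_default ?mul0r //; case: i le_pi.
Qed.

Lemma size_poly_prim p : (size (poly_prim p) <= (size p).+1)%N.
Proof. exact: size_poly. Qed.

Lemma poly_primK p : (poly_prim p)^`() = p.
Proof.
apply/polyP => i; rewrite coef_deriv coef_poly_prim /= -[LHS]mulr_natr.
by rewrite divfK // pnatr_eq0.
Qed.

Lemma poly_prim0 p : (poly_prim p).[0] = 0.
Proof. by rewrite horner_coef0 coef_poly_prim invr0 mulr0. Qed.

Definition integral01 p : R := (poly_prim p).[1].

Lemma integral01_deriv p : integral01 p^`() = p.[1] - p.[0].
Proof.
rewrite /integral01 (_ : poly_prim _ = p - p.[0]%:P) ?hornerE //.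
apply/polyP => -[|i]; rewrite coef_poly_prim coefB coefC /=.
  by rewrite invr0 mulr0 horner_coef0 subrr.
by rewrite coef_deriv subr0 -(mulr_natr p`_i.+1) mulfK // pnatr_eq0.
Qed.

Lemma integral01D p q : integral01 (p + q) = integral01 p + integral01 q.
Proof.
rewrite /integral01 -hornerD; congr (_.[1]); apply/polyP => i.
by rewrite coefD !coef_poly_prim coefD mulrDl.
Qed.

Lemma integral01Z a p : integral01 (a *: p) = a * integral01 p.
Proof.
rewrite /integral01 -hornerZ; congr (_.[1]); apply/polyP => i.
by rewrite coefZ !coef_poly_prim coefZ mulrA.
Qed.

Lemma integral01_sum (I : Type) (r : seq I) (F : I -> {poly R}) :
  integral01 (\sum_(i <- r) F i) = \sum_(i <- r) integral01 (F i).
Proof.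
apply: (big_morph integral01 integral01D).
by rewrite -(scale0r 0) integral01Z mul0r.
Qed.

End Primitive.

(** One Rolle point is taken in each gap between consecutive roots. The strict bounds allow the
    endpoints to be adjoined again when this is iterated. *)
Lemma poly_rolle_path (R : rcfType) (p : {poly R}) x s :
  path <%R x s -> all (root p) (x :: s) ->
  exists2 s', size s' = size s &
    [/\ sorted <%R s', all (root p^`()) s' &
        {in s', forall y, x < y < last x s}].
Proof.
elim: s x => [|y s IHs] x; first by exists [::].
move=> /= /andP[lt_xy ys] /andP[/rootP px /andP[/rootP py rs]].
have [|s' sz [srt rt bd]] := IHs y ys.
  by rewrite /= rs andbT; apply/rootP.
have le_y : y <= last y s.
  rewrite le_eqVlt; have := mem_last y s; rewrite inE => /orP[/eqP->|];
    first by rewrite eqxx.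
  by move/(allP (order_path_min lt_trans ys)) => ->; rewrite orbT.
have [z zxy pz] := poly_rolle lt_xy (etrans px (esym py)).
move: zxy; rewrite in_itv /= => /andP[xz zy].
exists (z :: s') => /=; first by rewrite sz.
split.
- rewrite path_min_sorted //; apply/allP => u /bd /andP[yu _].
  exact: lt_trans zy yu.
- by rewrite rt andbT; apply/rootP.
- move=> u; rewrite inE => /orP[/eqP->|/bd /andP[yu ->]].
    by rewrite xz (lt_le_trans zy).
  by rewrite (lt_trans lt_xy yu).
Qed.


(** Each differentiation costs at most one factor [q]. *)
Lemma exp_mul_derivn (R : comNzRingType) (q : {poly R}) m n :
  (n <= m)%N -> exists r, (q ^+ m)^`(n) = q ^+ (m - n) * r.
Proof.
elim: n => [|n IHn] lt_nm; first by exists 1; rewrite subn0 mulr1.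
have [r E] := IHn (ltnW lt_nm).
rewrite derivnS E derivM deriv_exp -subnS.
have ->: (m - n = (m - n.+1).+1)%N by rewrite subnSK.
exists ((q^`() * r) *+ (m - n.+1).+1 + q * r^`()).
by rewrite mulrDr exprSr; ring.
Qed.

Lemma derivn_comp_linear (R : comNzRingType) (p q : {poly R}) (a : R) n :
  q^`() = a%:P -> (p \Po q)^`(n) = a ^+ n *: (p^`(n) \Po q).
Proof.
move=> qa; elim: n => [|n IHn]; first by rewrite expr0 scale1r.
rewrite !derivnS IHn derivZ deriv_comp qa mulrC mul_polyC scalerA.
by rewrite exprSr.
Qed.

(** * Shifted Legendre polynomials: roots, orthogonality, symmetry *)

Section ShiftedLegendre.
Variable R : realType.

Definition rodrigues : {poly R} := (2%:P * 'X - 1) ^+ 2 - 1.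

(** By the chain rule each derivative in [t] instead of [u = 2t - 1] brings a factor 2. *)
Lemma LtildeE nu : Ltilde R nu = 2^-1 ^+ nu *: (rodrigues ^+ nu)^`(nu).
Proof.
have ->: rodrigues ^+ nu = ('X ^+ 2 - 1) ^+ nu \Po (2%:P * 'X - 1).
  by rewrite rmorphXn /= rmorphB /= rmorphXn /= comp_polyX rmorph1.
rewrite (@derivn_comp_linear _ _ _ 2); last by rewrite !derivE; ring.
by rewrite scalerA -exprMn mulVf ?expr1n ?scale1r // pnatr_eq0.
Qed.

Lemma rodrigues_derivn_root nu n :
  (n < nu)%N -> root (rodrigues ^+ nu)^`(n) 0 /\ root (rodrigues ^+ nu)^`(n) 1.
Proof.
move=> lt_n; have [r ->] := @exp_mul_derivn _ rodrigues nu n (ltnW lt_n).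
have ->: (nu - n = (nu - n).-1.+1)%N by lia.
by split; apply/rootP; rewrite exprS !hornerE; ring.
Qed.

(** Induction on [n]: for [n < nu] the [n] interior roots, together with 0 and 1, make [n + 2]
    roots, and Rolle yields [n + 1] for the next derivative. *)
Lemma rodrigues_derivn_roots nu n : (n <= nu)%N ->
  exists2 s, size s = n & [/\ sorted <%R s,
    all (root (rodrigues ^+ nu)^`(n)) s & {in s, forall x, 0 < x < 1}].
Proof.
elim: n => [|n IHn] lt_n; first by exists [::].
have [s sz [srt rt bd]] := IHn (ltnW lt_n).
have [r0 r1] := @rodrigues_derivn_root nu n lt_n.
have [|/=|s' sz' [srt' rt' bd']] :=
  @poly_rolle_path _ (rodrigues ^+ nu)^`(n) 0 (rcons s 1).
- rewrite rcons_path path_min_sorted ?srt /=; last first.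
    by apply/allP => x /bd /andP[].
  have := mem_last 0 s; rewrite inE => /orP[/eqP->|/bd/andP[]//].
  exact: ltr01.
- by rewrite r0 all_rcons r1.
exists s'; first by rewrite sz' size_rcons sz.
by split=> //; move: bd'; rewrite last_rcons.
Qed.

Lemma size_rodrigues_exp nu : size (rodrigues ^+ nu) = (2 * nu).+1.
Proof.
have sz : size rodrigues = 3.
  have ->: rodrigues = 4%:P * ('X * ('X - 1%:P)) by rewrite /rodrigues; ring.
  rewrite mul_polyC size_scale ?pnatr_eq0 // mulrC.
  by rewrite size_mulX ?polyXsubC_eq0 // size_XsubC.
have : rodrigues ^+ nu != 0 by rewrite expf_neq0 // -size_poly_eq0 sz.
by rewrite -size_poly_gt0 => /prednK <-; rewrite size_exp sz.
Qed.

Lemma size_Ltilde nu : size (Ltilde R nu) = nu.+1.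
Proof.
rewrite LtildeE size_scale ?expf_neq0 ?invr_eq0 ?pnatr_eq0 //.
by rewrite size_derivn size_rodrigues_exp; lia.
Qed.

Lemma Ltilde_roots nu : exists s : seq R,
  [/\ size s = nu, uniq s, {in s, forall x, 0 < x < 1} &
      forall x, root (Ltilde R nu) x = (x \in s)].
Proof.
have [s sz [srt rt bd]] := @rodrigues_derivn_roots nu nu (leqnn _).
have us : uniq s := lt_sorted_uniq srt.
have rL : all (root (Ltilde R nu)) s.
  apply/allP => x xs; rewrite LtildeE rootZ ?(allP rt) //.
  by rewrite expf_neq0 ?invr_eq0 ?pnatr_eq0.
exists s; split=> // x; apply/idP/idP => [rx|/(allP rL)//].
apply: contraT => xs.
have := @max_poly_roots _ (Ltilde R nu) (x :: s).
rewrite -size_poly_eq0 size_Ltilde /= rx xs us sz ltnn.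
by move=> /(_ isT rL isT).
Qed.

(** Repeated integration by parts moves the derivatives onto [k]; the boundary terms vanish by
    [rodrigues_derivn_root]. *)
Lemma Ltilde_orthogonal nu (k : {poly R}) :
  (size k <= nu)%N -> integral01 (Ltilde R nu * k) = 0.
Proof.
rewrite LtildeE -scalerAl integral01Z => szk.
suff H n : (n <= nu)%N -> forall q : {poly R}, (size q <= n)%N ->
    integral01 ((rodrigues ^+ nu)^`(n) * q) = 0 by rewrite H ?mulr0.
elim: n => [_ q|n IHn lt_n q szq].
  rewrite leqn0 size_poly_eq0 => /eqP->.
  by rewrite mulr0 -(scale0r 0) integral01Z mul0r.
have [/rootP r0 /rootP r1] := @rodrigues_derivn_root nu n lt_n.
set D := (rodrigues ^+ nu)^`(n) in IHn r0 r1 *.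
have := integral01_deriv (D * q); rewrite !hornerM r0 r1 !mul0r subrr.
rewrite derivM integral01D (IHn (ltnW lt_n) q^`()) ?addr0 -?derivnS //.
by rewrite size_deriv -subn1 leq_subLR.
Qed.

(** [rodrigues] is invariant under [t -> 1 - t], and each derivative contributes a sign. *)
Lemma Ltilde_symm nu : Ltilde R nu \Po (1 - 'X) = (-1) ^+ nu *: Ltilde R nu.
Proof.
rewrite LtildeE linearZ /= scalerA mulrC -scalerA; congr (_ *: _).
have E : rodrigues ^+ nu \Po (1 - 'X) = rodrigues ^+ nu.
  rewrite rmorphXn /=; congr (_ ^+ _).
  rewrite /rodrigues rmorphB rmorphXn !rmorphB /= rmorphM /=.
  rewrite comp_polyX rmorph1 comp_polyC.
  by ring.
rewrite -{2}E (@derivn_comp_linear _ _ (1 - 'X) (-1)); last first.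
  by rewrite !derivE sub0r polyCN.
by rewrite scalerA -exprMn mulrNN mul1r expr1n scale1r.
Qed.

Lemma Ltilde_root_symm nu x : root (Ltilde R nu) (1 - x) = root (Ltilde R nu) x.
Proof.
have := congr1 (horner^~ x) (Ltilde_symm nu).
rewrite horner_comp hornerZ !hornerE !rootE => ->.
by rewrite mulf_eq0 signr_eq0.
Qed.

Lemma Ltilde_deriv_symm nu x :
  (Ltilde R nu)^`().[1 - x] ^+ 2 = (Ltilde R nu)^`().[x] ^+ 2.
Proof.
have := congr1 (fun p => p^`().[x]) (Ltilde_symm nu).
rewrite /= deriv_comp derivZ !derivE hornerM horner_comp hornerZ !hornerE => E.
rewrite -sqrrN -mulrN1 E.
by rewrite exprMn sqrr_sign mul1r.
Qed.

End ShiftedLegendre.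

(* [v] annihilates the derivatives of all [h] of degree at most [c] with
   [h 0 = h 1 = 0]; such [h] are the multiples of ['X * (1 - 'X)]. *)
Definition kills_derivs (F : fieldType) (c : nat) (v : F -> F) (t : seq F) :=
  forall g : {poly F}, (size g < c)%N ->
    \sum_(x <- t) v x * ('X * (1 - 'X) * g)^`().[x] = 0.

(** * Lagrange interpolation at the roots of a polynomial *)

Section Nodes.
Variables (F : fieldType) (L : {poly F}) (s : seq F).
Hypotheses (size_L : size L = (size s).+1) (uniq_s : uniq s).
Hypothesis root_s : {in s, forall x, root L x}.

Definition node_poly (x : F) : {poly F} := L %/ ('X - x%:P).

Lemma node_polyE x : x \in s -> L = node_poly x * ('X - x%:P).
Proof. by move=> xs; apply/eqP; rewrite eqp_div_XsubC dvdp_XsubCl root_s. Qed.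

Lemma size_node_poly x : size (node_poly x) = size s.
Proof. by rewrite size_divp ?polyXsubC_eq0 // size_L size_XsubC subn1. Qed.

Lemma node_poly_eq0 x y : x \in s -> y \in s -> y != x -> (node_poly x).[y] = 0.
Proof.
move=> xs ys yx; have /rootP := @root_s y ys.
rewrite (node_polyE xs) !hornerE => /eqP.
by rewrite mulf_eq0 subr_eq0 (negPf yx) orbF => /eqP.
Qed.

Lemma deriv_node_poly x y : x \in s ->
  L^`().[y] = (node_poly x)^`().[y] * (y - x) + (node_poly x).[y].
Proof. by move=> xs; rewrite {1}(node_polyE xs) derivM derivXsubC !hornerE. Qed.

Lemma node_poly_diag x : x \in s -> (node_poly x).[x] = L^`().[x].
Proof. by move=> xs; rewrite (deriv_node_poly _ xs) subrr mulr0 add0r. Qed.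

(** Otherwise [node_poly x] would vanish at all nodes, more than its degree permits. *)
Lemma deriv_node_neq0 x : x \in s -> L^`().[x] != 0.
Proof.
move=> xs; apply/eqP => L0.
have: node_poly x = 0.
  apply: (@roots_geq_poly_eq0 _ _ s) => //; last by rewrite size_node_poly.
  apply/allP => y ys; apply/rootP; have [->|] := eqVneq y x.
    by rewrite node_poly_diag.
  exact: node_poly_eq0.
move/eqP; rewrite -size_poly_eq0 size_node_poly.
by case: (s) xs.
Qed.

Lemma sum_node_poly (a : F -> F) x : x \in s ->
  \sum_(y <- s) a y * (node_poly y).[x] = a x * L^`().[x].
Proof.
move=> xs; rewrite (bigD1_seq x) //= node_poly_diag // big_seq_cond big1 ?addr0 //.
by move=> y /andP[ys yx]; rewrite node_poly_eq0 ?mulr0 // eq_sym.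
Qed.

(** Both sides have degree below the number of nodes and agree at every node. *)
Lemma node_interpolation (b : {poly F}) : (size b <= size s)%N ->
  b = \sum_(x <- s) (b.[x] / L^`().[x]) *: node_poly x.
Proof.
move=> szb; apply/eqP; rewrite -subr_eq0; apply/eqP.
apply: (@roots_geq_poly_eq0 _ _ s) => //.
  apply/allP => x xs; apply/rootP; rewrite hornerD hornerN horner_sum.
  under eq_bigr do rewrite hornerZ.
  by rewrite sum_node_poly // divfK ?subrr // deriv_node_neq0.
rewrite (leq_trans (size_polyD _ _)) // geq_max szb size_polyN.
apply: (leq_trans (size_sum _ _ _)); apply/bigmax_leqP_seq => x _ _.
by rewrite (leq_trans (size_scale_leq _ _)) // size_node_poly.
Qed.

(* Testing against the product of two node polynomials isolates two nodes. *)
Lemma kills_derivs_weights (v : F -> F) x y :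
  kills_derivs (2 * size s) v s -> x \in s -> y \in s ->
  v x * (x * (1 - x) * L^`().[x] ^+ 2) = v y * (y * (1 - y) * L^`().[y] ^+ 2).
Proof.
move=> kv xs ys; have [->//|yx] := eqVneq x y.
have dE z : ('X * (1 - 'X) * (node_poly x * node_poly y))^`().[z] =
   (1 - z - z) * (node_poly x).[z] * (node_poly y).[z] +
   z * (1 - z) * ((node_poly x)^`().[z] * (node_poly y).[z] +
                  (node_poly x).[z] * (node_poly y)^`().[z]).
  by rewrite !derivE !hornerE /=; ring.
have dL u w : u \in s -> w \in s -> u != w ->
   (node_poly w)^`().[u] = L^`().[u] / (u - w).
  move=> us ws uw; rewrite (deriv_node_poly _ ws) node_poly_eq0 // addr0.
  by rewrite mulfK // subr_eq0.
have yx' : y != x by rewrite eq_sym.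
have := kv (node_poly x * node_poly y).
have s_gt0 : (0 < size s)%N by case: (s) xs.
have szM : (size (node_poly x * node_poly y)%R < 2 * size s)%N.
  by apply: (leq_ltn_trans (size_polyMleq _ _)); rewrite !size_node_poly; lia.
have sum2 (f : F -> F) : {in s, forall z, z != x -> z != y -> f z = 0} ->
    \sum_(z <- s) f z = f x + f y.
  move=> f0; rewrite (bigD1_seq x) //= -big_filter (bigD1_seq y) //=.
  - rewrite big_seq_cond big1 ?addr0 // => z /andP[].
    by rewrite mem_filter => /andP[zx zs]; exact: f0.
  - by rewrite mem_filter yx'.
  - exact: filter_uniq.
move=> /(_ szM); rewrite sum2 => [|z zs zx zy]; last first.
  by rewrite dE !node_poly_eq0 // !(mulr0, mul0r, addr0).
rewrite !dE (dL x y) // (dL y x) // (@node_poly_eq0 x y) //.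
rewrite (@node_poly_eq0 y x) // !node_poly_diag //.
move=> E; apply/eqP; rewrite -subr_eq0; apply/eqP.
have d0 : x - y != 0 by rewrite subr_eq0.
have d1 : y - x != 0 by rewrite subr_eq0.
(* The difference of the two sides is [x - y] times the vanishing sum [E]. *)
rewrite -(mulr0 (x - y)) -E; field.
by rewrite d0 d1.
Qed.

End Nodes.

Lemma sumr_gt0_seq (R : numDomainType) (I : eqType) (s : seq I) (f : I -> R) :
  s != [::] -> {in s, forall x, 0 < f x} -> 0 < \sum_(x <- s) f x.
Proof.
case: s => // x t _ f0; rewrite big_cons ltr_wpDr ?f0 ?mem_head //.
by rewrite big_seq sumr_ge0 // => y yt; rewrite ltW // f0 // inE yt orbT.
Qed.

(** * Exact quadrature rules and annihilation of derivatives *)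

Section Quadrature.
Variable R : realFieldType.
Implicit Types (L k : {poly R}) (s : seq R) (v : R -> R).

(** Divide [k] by [L]: orthogonality kills the quotient part, and the remainder is interpolated from
    its values at the nodes, which are those of [k]. *)
Lemma gauss_quadrature L s :
  size L = (size s).+1 -> uniq s -> {in s, forall x, root L x} ->
  (forall k, (size k <= size s)%N -> integral01 (L * k) = 0) ->
  exists w : R -> R, forall k, (size k <= 2 * size s)%N ->
    integral01 k = \sum_(x <- s) w x * k.[x].
Proof.
move=> szL us rs orth.
exists (fun x => integral01 (node_poly L x) / L^`().[x]) => k szk.
have L0 : L != 0 by rewrite -size_poly_eq0 szL.
rewrite {1}(divp_eq k L) integral01D mulrC orth ?add0r; last first.
  by rewrite size_divp // szL leq_subLR addnn -mul2n.
have szm : (size (k %% L)%R <= size s)%N by rewrite -ltnS -szL ltn_modp.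
rewrite {1}(node_interpolation szL us rs szm) integral01_sum.
apply: eq_big_seq => x xs; rewrite integral01Z {2}(divp_eq k L) !hornerE /=.
by rewrite (rootP (rs _ xs)); ring.
Qed.

Lemma exact_kills_derivs c v s :
  (forall k, (size k <= c)%N -> integral01 k = \sum_(x <- s) v x * k.[x]) ->
  kills_derivs c v s.
Proof.
move=> ex g szg; rewrite -ex.
  by rewrite integral01_deriv !hornerE /=; ring.
have sz2 : (size (('X * (1 - 'X))%R : {poly R}) <= 3)%N.
  have ->: 'X * (1 - 'X) = - (('X - 1%:P) * 'X) :> {poly R} by ring.
  by rewrite size_polyN size_mulX ?polyXsubC_eq0 // size_XsubC.
rewrite size_deriv -subn1 leq_subLR.
apply: (leq_trans (size_polyMleq _ _)); rewrite -subn1 leq_subLR.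
by have := leq_add sz2 szg; rewrite addnS.
Qed.

Lemma kills_derivs_exact c v s k :
  (0 < c)%N -> kills_derivs c v s -> (size k <= c)%N ->
  \sum_(x <- s) v x * k.[x] = (\sum_(x <- s) v x) * integral01 k.
Proof.
move=> c0 kv szk.
(* The linear correction makes [h] vanish at 1 as well as at 0, while [h'] is [k] minus its
   integral. *)
set h := poly_prim k - integral01 k *: 'X.
have szh : (size h <= c.+1)%N.
  rewrite (leq_trans (size_polyD _ _)) // geq_max size_polyN.
  rewrite (leq_trans (size_poly_prim _)) //=.
  by rewrite (leq_trans (size_scale_leq _ _)) // size_polyX.
have /factor_theorem[q hq] : root h 0.
  by apply/rootP; rewrite !hornerE poly_prim0 subrr.
have /factor_theorem[r qr] : root q 1.
  have := congr1 (horner^~ 1) hq.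
  rewrite !hornerE /= /integral01 subrr subr0 mulr1 => /esym q1.
  exact/rootP.
have E : h = 'X * (1 - 'X) * - r by rewrite hq qr polyC0; ring.
have szr : (size (- r)%R < c)%N.
  (* Removing the two linear factors lowers the size of [h] by two, provided [r] is nonzero; for
     [r = 0] the bound is [0 < c]. *)
  rewrite size_polyN; have [->|r0] := eqVneq r 0; first by rewrite size_poly0.
  have := szh; rewrite hq qr !size_mul ?mulf_neq0 ?polyXsubC_eq0 // !size_XsubC.
  by rewrite !addn2.
have := kv _ szr; rewrite -E /h derivB poly_primK derivZ derivX.
under eq_bigr do rewrite !hornerE mulrBr.
by rewrite sumrB -mulr_suml => /eqP; rewrite subr_eq0 => /eqP.
Qed.

End Quadrature.

(** * From indistinguishability to annihilation of derivatives *)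

Section Bias.
Variable R : realType.
Implicit Types (P : R -> R) (s : seq R).

(** Since [sigma p] is [sqrt (p (1 - p)) / p], the bracket in [fbias] is [sqrt (p (1 - p))] times
    the logarithmic derivative of the monomial before it. *)
Lemma fbias_deriv i j (p : R) : 0 < p < 1 ->
  fbias (i.+1 + j.+1) i.+1 p =
  Num.sqrt (p * (1 - p)) * ('X^(i.+1) * (1 - 'X) ^+ j.+1)^`().[p].
Proof.
move=> /andP[p0 p1]; have q0 : 0 < 1 - p by rewrite subr_gt0.
have sigE (x y : R) : 0 < x -> 0 < y -> Num.sqrt (y / x) = Num.sqrt (x * y) / x.
  move=> x0 y0; have ->: y / x = x * y * (x^-1) ^+ 2 by field; exact: lt0r_neq0.
  rewrite mulrC sqrtrM ?sqr_ge0 // sqrtr_sqr ger0_norm ?invr_ge0 ?ltW //.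
  by rewrite mulrC.
rewrite /fbias /sigma sigE // subKr sigE // [(1 - p) * p]mulrC addKn.
rewrite derivM !deriv_exp !derivE !(hornerE, hornerMn) /= !exprS; field.
by rewrite !lt0r_neq0.
Qed.

Lemma fbias_symm l x (p : R) : (x <= l)%N -> fbias l x (1 - p) = - fbias l (l - x) p.
Proof.
move=> xl; rewrite /fbias subKn // subKr.
by ring.
Qed.

Lemma fbd_Ex_symm P s g : is_fbd P s -> Ex P s (fun x => g (1 - x)) = Ex P s g.
Proof.
move=> [[us ms] _ _ _ sym].
have K : involutive (fun x : R => 1 - x) by move=> x; rewrite subKr.
have E : perm_eq s (map (fun x => 1 - x) s).
  apply: uniq_perm => // [|x]; first by rewrite map_inj_uniq //; exact: can_inj K.
  by have := mem_map (can_inj K) s (1 - x); rewrite subKr !ms sym => ->.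
rewrite /Ex [RHS](perm_big _ E) big_map; apply: eq_bigr => x _.
by rewrite sym.
Qed.

Lemma indistinguishableE c P s : is_fbd P s -> indistinguishable c P s <->
  forall i j, (i.+1 + j.+1 <= c)%N -> Ex P s (fbias (i.+1 + j.+1) i.+1) = 0.
Proof.
move=> fbd; split=> [ind i j le_c|ex0 l /andP[l2 lc]].
  have le0 x : (0 < x < i.+1 + j.+1)%N -> Ex P s (fbias (i.+1 + j.+1) x) <= 0.
    move=> xl; have /eqP := ind (i.+1 + j.+1)%N ltac:(lia).
    rewrite psumr_eq0 => [/allP/(_ x)|y _]; last first.
      by rewrite mulr_ge0 ?ler0n // /Rlx le_max lexx.
    rewrite mem_index_iota => /(_ xl) /=; rewrite mulf_eq0 pnatr_eq0.
    rewrite -leqn0 leqNgt bin_gt0 (ltnW (proj2 (andP xl))) /= => /eqP <-.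
    by rewrite /Rlx le_max lexx orbT.
  (* Reflection [p -> 1 - p] turns the bound for the index [l - x] into the reverse inequality for
     [x]. *)
  apply: le_anti; rewrite le0 /=; last by lia.
  rewrite -(fbd_Ex_symm _ fbd) /Ex.
  under eq_bigr do rewrite fbias_symm ?leq_addr // mulrN addKn.
  by rewrite sumrN oppr_ge0; apply: le0; lia.
rewrite big_nat big1 // => x /andP[x0 xl].
have E : l = (x.-1.+1 + (l - x).-1.+1)%N by lia.
have := ex0 x.-1 (l - x).-1%N; rewrite -E prednK // /Rlx => -> //.
by rewrite maxxx mulr0.
Qed.

Lemma indistinguishable_kills_derivs c P s : is_fbd P s ->
  indistinguishable c P s <->
  kills_derivs c (fun x => P x * Num.sqrt (x * (1 - x))) s.
Proof.
move=> fbd; have [_ _ _ s01 _] := fbd; rewrite indistinguishableE //.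
have ExE i j : Ex P s (fbias (i.+1 + j.+1) i.+1) =
    \sum_(x <- s) P x * Num.sqrt (x * (1 - x)) *
       ('X * (1 - 'X) * ('X^i * (1 - 'X) ^+ j))^`().[x].
  apply: eq_big_seq => x xs; rewrite fbias_deriv ?s01 // -[RHS]mulrA.
  rewrite (_ : 'X * (1 - 'X) * _ = 'X^(i.+1) * (1 - 'X) ^+ j.+1) //.
  by rewrite !exprS; ring.
split=> [ex0 g szg|kv i j le_c]; last first.
  rewrite ExE kv // (leq_ltn_trans (size_polyMleq _ _)) // size_polyXn.
  have sz : size (1 - 'X : {poly R})%R = 2%N.
    by rewrite -opprB size_polyN -polyC1 size_XsubC.
  have := size_poly_exp_leq (1 - 'X : {poly R}) j; rewrite sz mul1n => szj.
  by rewrite addSn /= (leq_ltn_trans (leq_add (leqnn i) szj)) //; lia.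
(* Expand [g] in the monomials [X^i], which are the test polynomials with [j = 0]. *)
rewrite -[g]coefK poly_def mulr_sumr raddf_sum /=.
under eq_bigr do rewrite horner_sum mulr_sumr.
rewrite exchange_big big1 //= => i _.
under eq_bigr do rewrite -scalerAr derivZ hornerZ mulrCA.
rewrite -mulr_sumr -[X in _ * X](_ : Ex P s (fbias (i.+1 + 1) i.+1) = _).
  by rewrite ex0 ?mulr0 // addn1; apply: leq_trans szg; exact: ltn_ord.
by rewrite ExE expr0 mulr1.
Qed.

End Bias.

(** * The Gauss-Legendre rule and its weights *)

Section GaussLegendre.
Variables (R : realType) (nu : nat).
Hypothesis nu_gt0 : (0 < nu)%N.
Local Notation L := (Ltilde R nu).

Lemma gauss_legendre : exists (s : seq R) (w : R -> R) (K : R),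
  [/\ [/\ size s = nu, uniq s, {in s, forall x, 0 < x < 1} &
          forall x, root L x = (x \in s)],
      forall k : {poly R}, (size k <= 2 * nu)%N ->
        integral01 k = \sum_(x <- s) w x * k.[x],
      0 < K &
      {in s, forall x, 0 < x * (1 - x) * L^`().[x] ^+ 2 /\
        w x = K / (x * (1 - x) * L^`().[x] ^+ 2)}].
Proof.
have [s [sz us s01 rt]] := Ltilde_roots R nu.
have szL : size L = (size s).+1 by rewrite size_Ltilde sz.
have rs : {in s, forall x, root L x} by move=> x; rewrite rt.
have := gauss_quadrature szL us rs; rewrite sz => -[k|w ex].
  exact: Ltilde_orthogonal.
have dpos x : x \in s -> 0 < x * (1 - x) * L^`().[x] ^+ 2.
  move=> xs; have /andP[x0 x1] := s01 x xs.
  have A0 : 0 < x * (1 - x) by rewrite mulr_gt0 ?subr_gt0.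
  rewrite (pmulr_rgt0 _ A0) exprn_even_gt0 //=.
  exact: deriv_node_neq0 szL us rs _ xs.
have kw : kills_derivs (2 * size s) w s.
  by apply: exact_kills_derivs; rewrite sz.
have [x0 x0s] : exists x0, x0 \in s.
  by case: (s) sz nu_gt0 => [<-//|x t _ _]; exists x; rewrite mem_head.
(* By [kills_derivs_weights] this value is the same at every node. *)
set K := w x0 * (x0 * (1 - x0) * L^`().[x0] ^+ 2).
have wE x : x \in s -> w x = K / (x * (1 - x) * L^`().[x] ^+ 2).
  move=> xs; rewrite /K (kills_derivs_weights szL us rs kw x0s xs).
  by rewrite mulfK // lt0r_neq0 ?dpos.
exists s, w, K; split=> //; last by move=> x xs; rewrite dpos // wE.
have sum_w : \sum_(x <- s) w x = 1.
  have := ex 1; rewrite size_poly1 muln_gt0 nu_gt0 => /(_ isT).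
  have ->: integral01 1 = 1 :> R.
    by rewrite -(derivX R) integral01_deriv !hornerX subr0.
  by under eq_bigr do rewrite hornerC mulr1.
(* If [K <= 0], no weight would be positive, although the weights sum to 1. *)
rewrite ltNge; apply/negP => K0.
have : \sum_(x <- s) w x <= 0.
  rewrite big_seq sumr_le0 // => x xs; rewrite wE //.
  by rewrite mulr_le0_ge0 // invr_ge0 ltW ?dpos.
by rewrite sum_w ler10.
Qed.

Lemma Pnu_scale (C : R) x : Pnu nu C x = C * Pnu nu 1 x.
Proof. by rewrite /Pnu; case: ifP => _; rewrite ?mulr0 // mul1r. Qed.

(** The square root reduces the exponent 3/2 to 1, which gives the shape of the Gauss weights. *)
Lemma Pnu_sqrt (C x : R) : root L x -> 0 < x < 1 ->
  Pnu nu C x * Num.sqrt (x * (1 - x)) = C / (x * (1 - x) * L^`().[x] ^+ 2).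
Proof.
move=> rx /andP[x0 x1]; rewrite /Pnu rx.
have A0 : 0 < x * (1 - x) by rewrite mulr_gt0 ?subr_gt0.
have : Num.sqrt (x * (1 - x)) != 0 by rewrite lt0r_neq0 ?sqrtr_gt0.
have := sqr_sqrtr (ltW A0); move: (Num.sqrt _) => r <- r0.
by rewrite exprSr [r ^+ 2 * r * _]mulrAC invfM mulrA divfK.
Qed.

Lemma Pnu_symm (C x : R) : Pnu nu C (1 - x) = Pnu nu C x.
Proof.
by rewrite /Pnu Ltilde_root_symm Ltilde_deriv_symm subKr [(1 - x) * x]mulrC.
Qed.

End GaussLegendre.

Theorem theorem3 (R : realType) (nu : nat) (hnu : (1 <= nu)%N) :
  exists C : R, 0 < C /\
    (* P_{2nu} is a (2nu)-indistinguishable finite bias distribution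
       with exactly nu possible outputs *)
    (exists s : seq R, [/\ is_fbd (Pnu nu C) s,
                           indistinguishable (2 * nu) (Pnu nu C) s &
                           size s = nu]) /\
    (* every (2nu)-indistinguishable finite bias distribution has at least
       nu possible outputs *)
    (forall (P : R -> R) (s : seq R), is_fbd P s ->
        indistinguishable (2 * nu) P s -> (nu <= size s)%N) /\
    (* and those with exactly nu outputs are P_{2nu} *)
    (forall (P : R -> R) (s : seq R), is_fbd P s ->
        indistinguishable (2 * nu) P s -> size s = nu -> P = Pnu nu C).
Proof.
have [s0 [w [K [[sz us s01 rt] ex K0 wE]]]] := @gauss_legendre R nu hnu.
set L := Ltilde R nu in rt wE.
have szL : size L = (size s0).+1 by rewrite size_Ltilde sz.
have rs : {in s0, forall x, root L x} by move=> x; rewrite rt.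
have Dpos x : x \in s0 -> 0 < Pnu nu 1 x.
  move=> xs; rewrite /Pnu rt xs mul1r invr_gt0.
  have /andP[x0 x1] := s01 x xs; have [+ _] := wE x xs.
  have A0 : 0 < x * (1 - x) by rewrite mulr_gt0 ?subr_gt0.
  by rewrite (pmulr_rgt0 _ A0) => ?; apply: mulr_gt0 => //;
    rewrite exprn_gt0 ?sqrtr_gt0.
(* The normalizing constant will be [S^-1]. *)
set S := \sum_(x <- s0) Pnu nu 1 x.
have S0 : 0 < S.
  by apply: sumr_gt0_seq Dpos; rewrite -size_eq0 sz -lt0n.
have memP (C : R) x : 0 < C -> (x \in s0) = (0 < Pnu nu C x).
  move=> C0; rewrite Pnu_scale pmulr_rgt0 //; apply/idP/idP => [/Dpos//|].
  by rewrite /Pnu rt; case: ifP => //; rewrite ltxx.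
have geP (C : R) x : 0 < C -> 0 <= Pnu nu C x.
  move=> C0; have [xs|xs] := boolP (x \in s0); first by rewrite ltW // -memP.
  by rewrite /Pnu rt (negPf xs).
have supp P s : is_fbd P s -> indistinguishable (2 * nu) P s ->
    (size s <= nu)%N -> {subset s0 <= s}.
  move=> fbd /(indistinguishable_kills_derivs _ fbd) kv le_s y ys.
  have [[u ms] _ sum1 bd _] := fbd.
  set v := fun x => _ in kv.
  have V0 : 0 < \sum_(x <- s) v x.
    have vpos x : x \in s -> 0 < v x.
      move=> xs; have /andP[x0 x1] := bd x xs.
      by rewrite mulr_gt0 -?ms // sqrtr_gt0 mulr_gt0 ?subr_gt0.
    apply: sumr_gt0_seq vpos; case: (s) sum1 => //.
    by rewrite big_nil => /esym/eqP; rewrite oner_eq0.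
  (* For the test polynomial [M * node_poly L y] the sum over [s] is zero, while the Gauss rule on
     [s0] retains only the node [y]; hence [M] vanishes at [y]. *)
  set M := \prod_(x <- s) ('X - x%:P).
  have szM : (size (M * node_poly L y)%R <= 2 * nu)%N.
    rewrite (leq_trans (size_polyMleq _ _)) // size_prod_XsubC.
    by rewrite (size_node_poly szL) sz addSn mul2n -addnn leq_add2r.
  have c0 : (0 < 2 * nu)%N by rewrite muln_gt0.
  have := kills_derivs_exact c0 kv szM.
  move: (\sum_(x <- s) v x) V0 => V V0; rewrite ex // big_seq big1 => [|x xs]; last first.
    have /rootP : root M x by rewrite root_prod_XsubC.
    by rewrite hornerM => ->; rewrite mul0r mulr0.
  rewrite (bigD1_seq y) //= big_seq_cond big1 => [|x /andP[xs xy]]; last first.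
    by rewrite hornerM (node_poly_eq0 rs) // !mulr0.
  rewrite addr0 hornerM (node_poly_diag rs) // => /esym/eqP.
  have [dpos ->] := wE y ys.
  have L0 := deriv_node_neq0 szL us rs ys.
  have Kd0 := lt0r_neq0 (divr_gt0 K0 dpos).
  rewrite mulf_eq0 (negPf (lt0r_neq0 V0)) /= mulf_eq0 (negPf Kd0) /=.
  by rewrite mulf_eq0 (negPf L0) orbF -rootE root_prod_XsubC.
exists S^-1; have C0 : 0 < S^-1 by rewrite invr_gt0.
have fbd0 : is_fbd (Pnu nu S^-1) s0.
  split=> //; first by split=> // x; exact: memP.
  - by move=> x; exact: geP.
  - under eq_bigr do rewrite Pnu_scale.
    by rewrite -mulr_sumr mulVf ?lt0r_neq0.
  - exact: Pnu_symm.
split=> //; split.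
  exists s0; split=> //; apply/(indistinguishable_kills_derivs _ fbd0) => g szg.
  have kw : kills_derivs (2 * nu) w s0 by exact: exact_kills_derivs.
  (* At the nodes, [Pnu] times the square root is [S^-1 / K] times the Gauss weight. *)
  transitivity (S^-1 / K * \sum_(x <- s0) w x * ('X * (1 - 'X) * g)^`().[x]);
    last by rewrite kw ?mulr0.
  rewrite mulr_sumr; apply: eq_big_seq => x xs; have [_ ->] := wE x xs.
  rewrite Pnu_sqrt ?rs ?s01 // [RHS]mulrA; congr (_ * _).
  by rewrite [RHS]mulrA divfK ?lt0r_neq0.
split=> [P s fbd ind|P s fbd ind szs].
  rewrite leqNgt; apply/negP => lt_s.
  have := uniq_leq_size us (supp P s fbd ind (ltnW lt_s)).
  by rewrite sz leqNgt lt_s.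
have sub : {subset s0 <= s} := supp P s fbd ind (eq_leq szs).
have [_ eqs] : (size s0 = size s) * (s0 =i s).
  by apply: uniq_min_size; rewrite // szs sz.
have [[u ms] P_ge0 sum1 _ _] := fbd.
have ps : perm_eq s s0 by apply: uniq_perm => // x; rewrite eqs.
have kv : kills_derivs (2 * size s0) (fun x => P x * Num.sqrt (x * (1 - x))) s0.
  rewrite sz => g szg; rewrite -(perm_big _ ps) /=.
  exact: ((indistinguishable_kills_derivs _ fbd).1 ind).
have [y ys] : exists y, y \in s0.
  by case: (s0) sz hnu => [<-//|x t _ _]; exists x; rewrite mem_head.
(* Again independent of the chosen node, so [P] is proportional to [Pnu nu 1] with factor [c]. *)
pose c := P y * Num.sqrt (y * (1 - y)) * (y * (1 - y) * L^`().[y] ^+ 2).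
have PE x : P x = c * Pnu nu 1 x.
  have [xs|xs] := boolP (x \in s0); last first.
    rewrite [Pnu _ _ _]ifF ?mulr0; last by rewrite rt (negPf xs).
    by apply: le_anti; rewrite P_ge0 andbT leNgt -ms -eqs.
  have /andP[x0 x1] := s01 x xs.
  have S1 : Num.sqrt (x * (1 - x)) != 0.
    by rewrite lt0r_neq0 // sqrtr_gt0 mulr_gt0 ?subr_gt0.
  apply: (mulIf S1); rewrite -mulrA Pnu_sqrt ?rs ?s01 //.
  rewrite /c (kills_derivs_weights szL us rs kv ys xs).
  have [d0 _] := wE x xs.
  by rewrite div1r mulfK // lt0r_neq0.
suff cE : c = S^-1 by apply/funext => x; rewrite PE cE -Pnu_scale.
(* Comparing total masses gives [c * S = 1]. *)
apply/eqP; rewrite -[c]mulr1 -(mulfV (lt0r_neq0 S0)) mulrA mulr_sumr.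
under eq_bigr do rewrite -PE.
by rewrite -(perm_big _ ps) /= sum1 mul1r.
Qed.
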